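(* Let $\mathcal{S}_0:=\mathcal{X}^{[\mathcal{L}]}$ and $\mathcal{S}_{i+1}:=\mathcal{C}(\mathcal{S}_i)\cap\mathcal{S}_0$ for $i\ge 0$, and let $\mathcal{B}\subset\mathbb{R}^N$ be any compact set satisfying $\mathcal{V}\cap\mathcal{X}^{[\mathcal{L}]}\subseteq\mathcal{B}$. Then there exists a finite integer $\overline{k}\geq 1$ such that $$\mathcal{S}_{\overline{k}}\cap\mathcal{B}=\mathcal{S}_{\overline{k}+1}\cap\mathcal{B},$$ and the maximal admissible invariant set $\mathcal{M}$ with respect to the system $x(t+1)=A_{\sigma(t)}x(t)$ and the constraints $x(t)\in\mathcal{X}$ is $\mathcal{M}=\operatorname{lower}(\mathcal{S}_{\overline{k}})$.
   Context: System. Let $\mathcal{A}=\{A_1,\dots,A_M\}\subset\mathbb{R}^{n\times n}$. The switching system is $x(t+1)=A_{\sigma(t)}x(t)$, $t\in\mathbb{N}=\{0,1,2,\dots\}$, where $x(0)\in\mathbb{R}^n$ and $\sigma:\mathbb{N}\to\{1,\dots,M\}$ is an arbitrary switching signal. Constraint set. $\mathcal{X}=\{x\in\mathbb{R}^n: c_i(x)\le 1,\ i=1,\dots,p\}$, where $c_1,\dots,c_p$ are real polynomials of maximum degree $d\ge 1$, with no constant term (all monomials have degree in $\{1,\dots,d\}$). The state constraints are $x(t)\in\mathcal{X}$ for all $t\ge 0$. Standing assumptions. (1) The system is asymptotically stable (under arbitrary switching); equivalently, the joint spectral radius $\rho(\mathcal{A})=\lim_{t\to\infty}\max\{\|A\|^{1/t}: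 A \text{ a product of } t \text{ elements of } \mathcal{A}\}$ satisfies $\rho(\mathcal{A})<1$. (2) $\mathcal{X}$ is closed, bounded and contains the origin in its interior. Invariance. A set $\mathcal{S}\subset\mathbb{R}^n$ is invariant with respect to the system if $x(0)\in\mathcal{S}$ implies $x(t)\in\mathcal{S}$ for all $t\in\mathbb{N}$ and all switching signals; it is admissible invariant if moreover $\mathcal{S}\subseteq\mathcal{X}$. The maximal admissible invariant set $\mathcal{M}$ is the admissible invariant set that contains every admissible invariant set. Lifting. For an integer $l\ge 1$, the $l$-lift $x^{[l]}\in\mathbb{R}^{\binom{n+l-1}{l}}$ of $x\in\mathbb{R}^n$ is the vector with entries $\sqrt{\alpha!}\,x^\alpha$, over all $\alpha\in\mathbb{N}^n$ with $\sum_i\alpha_i=l$ (in a fixed order), where $x^\alpha=x_1^{\alpha_1}\cdots x_n^{\alpha_n}$ and $\alpha!:=\frac{l!}{\alpha_1!\cdots\alpha_n!}$ denotes the multinomial coefficient. For $A\in\mathbb{R}^{n\times n}$, $A^{[l]}$ is the matrix of the linear map satisfying $A^{[l]}x^{[l]}=(Ax)^{[l]}$ for all $x\in\mathbb{R}^n$. Let $\mathcal{L}=\{l_1,\dots,l_K\}\subseteq\{1,\dots,d\}$ (ordered) be the set of degrees of all monomials appearing in $c_1,\dots,c_p$, and $N=\sum_{l\in\mathcal{L}}\binom{n+l-1}{l}$. Then $x^{[\mathcal{L}]}\in\mathbb{R}^N$ is obtained by stacking $x^{[l_1]},\dots,x^{[l_K]}$, and $A_i^{[\mathcal{L}]}:=\operatorname{diag}(A_i^{[l_1]},\dots,A_i^{[l_K]})$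 (block diagonal). Let $g_i\in\mathbb{R}^N$ be the vector with $c_i(x)=g_i^\top x^{[\mathcal{L}]}$ for all $x$. Define $\mathcal{X}^{[\mathcal{L}]}:=\{y\in\mathbb{R}^N: g_i^\top y\le 1,\ i=1,\dots,p\}$ and $\mathcal{V}:=\{x^{[\mathcal{L}]}: x\in\mathbb{R}^n\}\subset\mathbb{R}^N$. Maps. For $\mathcal{S}\subseteq\mathbb{R}^N$: $\operatorname{lower}(\mathcal{S}):=\{x\in\mathbb{R}^n: x^{[\mathcal{L}]}\in\mathcal{S}\}$, and the pre-image map is $\mathcal{C}(\mathcal{S}):=\{y\in\mathbb{R}^N: A_i^{[\mathcal{L}]}y\in\mathcal{S}\ \text{for all } i=1,\dots,M\}$. *)

(* Defs.v *)
From HB Require Import structures.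
From mathcomp Require Import all_boot all_order all_algebra.
From mathcomp Require Import all_classical all_reals all_analysis.
From mathcomp Require mpoly.
(* The notations of mpoly clash with those of MathComp-Analysis. *)
Import -(notations) mpoly.

Set Implicit Arguments.
Unset Strict Implicit.
Unset Printing Implicit Defensive.

Import Order.TTheory GRing.Theory Num.Theory numFieldNormedType.Exports.
Local Open Scope classical_set_scope.
Local Open Scope ring_scope.

Section SwitchingSystem.
Variables (R : realType) (n M : nat).
Implicit Types (A : 'I_M -> 'M[R]_n) (sigma : nat -> 'I_M).
Implicit Types (S X : set 'cV[R]_n).

Fixpoint trajectory A sigma (x0 : 'cV[R]_n) (t : nat) : 'cV[R]_n :=
  if t is t'.+1 then A (sigma t') *m trajectory A sigma x0 t' else x0.

(* For every signal the origin is Lyapunov stable and attractive; delta may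
   depend on sigma, which is the weakest of the usual variants. *)
Definition asymptotically_stable A := forall sigma,
  (forall eps : R, 0 < eps -> exists2 delta : R, 0 < delta &
    forall x0, `|x0| < delta -> forall t, `|trajectory A sigma x0 t| < eps) /\
  (forall x0, trajectory A sigma x0 @ \oo --> (0 : 'cV[R]_n)).

Definition invariant A S := forall x0, S x0 ->
  forall sigma t, S (trajectory A sigma x0 t).

Definition admissible_invariant A X S := invariant A S /\ S `<=` X.

Definition maximal_admissible_invariant A X S :=
  admissible_invariant A X S /\
  forall S', admissible_invariant A X S' -> S' `<=` S.

End SwitchingSystem.

Section Lifting.
Variables (R : realType) (n : nat).

(* Exponent vectors a with |a| = l; the coordinates of the l-lift are indexed by
   their enumeration. *)
Definition multi (l : nat) : {set n.-tuple 'I_l.+1} :=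
  [set a : n.-tuple 'I_l.+1 | \sum_(i <- a) i == l]%N%SET.

Definition monom l (a : n.-tuple 'I_l.+1) (x : 'cV[R]_n) : R :=
  \prod_(i < n) x i 0 ^+ tnth a i.

(* The multinomial coefficient l! / (a_1! ... a_n!), as a real number. *)
Definition multinom_coef l (a : n.-tuple 'I_l.+1) : R :=
  l`!%:R / (\prod_(i < n) (tnth a i)`!)%:R.

Definition vlift l (x : 'cV[R]_n) : 'cV[R]_#|multi l| :=
  \col_k (Num.sqrt (multinom_coef (enum_val k)) * monom (enum_val k) x).

(* The unique matrix with mxlift l A *m vlift l x = vlift l (A *m x) for all x,
   see mxliftE and mxlift_uniq below. *)
Definition mxlift l (A : 'M[R]_n) : 'M[R]_#|multi l| :=
  xget 0 [set B | forall x, B *m vlift l x = vlift l (A *m x)].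

Definition liftdim (L : seq nat) : nat :=
  (\sum_(k < size L) #|multi (nth 0 L k)|)%N.

Definition vliftL (L : seq nat) (x : 'cV[R]_n) : 'cV[R]_(liftdim L) :=
  \mxcol_(k < size L) vlift (nth 0%N L k) x.

Definition mxliftL (L : seq nat) (A : 'M[R]_n) : 'M[R]_(liftdim L) :=
  \mxdiag_(k < size L) mxlift (nth 0%N L k) A.

Definition lower (L : seq nat) (S : set 'cV[R]_(liftdim L)) : set 'cV[R]_n :=
  [set x | S (vliftL L x)].

Definition veronese (L : seq nat) : set 'cV[R]_(liftdim L) := range (vliftL L).

Definition preim_map M (A : 'I_M -> 'M[R]_n) (L : seq nat)
    (S : set 'cV[R]_(liftdim L)) : set 'cV[R]_(liftdim L) :=
  [set y | forall i, S (mxliftL L (A i) *m y)].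

End Lifting.

Arguments vliftL {R n} L x.
Arguments mxliftL {R n} L A.
Arguments veronese {R n} L.

Section Constraints.
Variables (R : realType) (n p : nat) (c : 'I_p -> mpoly n R).

Definition peval (q : mpoly n R) (x : 'cV[R]_n) : R :=
  meval (fun j => x j 0) q.

Definition constraint_set : set 'cV[R]_n := [set x | forall i, peval (c i) x <= 1].

Definition degrees : seq nat :=
  sort leq (undup (flatten
    [seq [seq mdeg m | m <- msupp (c i)] | i <- enum 'I_p])).

(* The unique vector with c i = g^T x^[L] for all x, see constraint_vecE and
   constraint_vec_uniq below. *)
Definition constraint_vec (i : 'I_p) : 'cV[R]_(liftdim n degrees) :=
  xget 0 [set g | forall x, peval (c i) x = (g^T *m vliftL degrees x) 0 0].

Definition lifted_constraint_set : set 'cV[R]_(liftdim n degrees) :=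
  [set y | forall i, ((constraint_vec i)^T *m y) 0 0 <= 1].

Fixpoint lifted_iter M (A : 'I_M -> 'M[R]_n) (k : nat) :
    set 'cV[R]_(liftdim n degrees) :=
  if k is k'.+1
  then preim_map A (lifted_iter A k') `&` lifted_constraint_set
  else lifted_constraint_set.

End Constraints.

Arguments constraint_set {R n p} c.
Arguments lifted_constraint_set {R n p} c.
Arguments lifted_iter {R n p} c {M} A k.

Lemma card_multi (n l : nat) : (0 < l)%N -> #|multi n l| = 'C(n + l - 1, l).
Proof.
case: n => [|n] l_gt0.
  rewrite bin_small; last by rewrite add0n subn1 prednK.
  apply/eqP; rewrite cards_eq0; apply/eqP/setP => a.
  by rewrite !inE tuple0 big_nil eq_sym; apply/negbTE; rewrite -lt0n.
by rewrite /multi card_ord_partitions addSn subSS subn0 -bin_sub ?leq_addr// addKn.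
Qed.

Lemma multinom_coef_gt0 (R : realType) (n l : nat) (a : n.-tuple 'I_l.+1) :
  0 < multinom_coef R a.
Proof.
by rewrite divr_gt0// ltr0n ?fact_gt0// prodn_gt0// => i; rewrite fact_gt0.
Qed.

Lemma sqrt_multinom_coef_gt0 (R : realType) (n l : nat) (a : n.-tuple 'I_l.+1) :
  0 < Num.sqrt (multinom_coef R a).
Proof. by rewrite sqrtr_gt0 multinom_coef_gt0. Qed.

Lemma digits_inj (b n : nat) (f g : 'I_n -> nat) :
  (forall i, f i < b)%N -> (forall i, g i < b)%N ->
  (\sum_(i < n) f i * b ^ i = \sum_(i < n) g i * b ^ i)%N -> f =1 g.
Proof.
elim: n f g => [|n IHn] f g fb gb; first by move=> _ [].
have b_gt0 : (0 < b)%N by exact: leq_trans (fb ord0).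
have shift (h : 'I_n.+1 -> nat) : (\sum_(i < n.+1) h i * b ^ i =
    (\sum_(i < n) h (lift ord0 i) * b ^ i) * b + h ord0)%N.
  rewrite big_ord_recl expn0 muln1 addnC big_distrl /=; congr addn.
  by apply: eq_bigr => i _; rewrite -mulnA -expnSr.
rewrite !shift => E.
have E0 : f ord0 = g ord0.
  by have := congr1 (modn^~ b) E; rewrite !modnMDl !modn_small.
have ES : (fun i => f (lift ord0 i)) =1 (fun i => g (lift ord0 i)).
  apply: IHn => // ; move: E; rewrite E0 => /addIn/eqP.
  by rewrite eqn_pmul2r// => /eqP.
by move=> i; case: (unliftP ord0 i) => [j ->|->//]; exact: ES.
Qed.

Lemma monom_free (R : realType) (n : nat) (I : finType) (e : I -> 'I_n -> nat)
    (u : I -> R) :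
  (forall k k', e k =1 e k' -> k = k') ->
  (forall x : 'cV[R]_n, \sum_k u k * \prod_(i < n) x i 0 ^+ e k i = 0) ->
  forall k, u k = 0.
Proof.
move=> e_inj u0 k0.
pose b := (\max_k \max_(i < n) e k i).+1.
have eb k i : (e k i < b)%N.
  rewrite ltnS (leq_trans _ (leq_bigmax k))//.
  exact: (leq_bigmax (F := fun i => e k i) i).
pose E k := (\sum_(i < n) e k i * b ^ i)%N.
have E_inj k k' : (E k == E k') = (k == k').
  by apply/eqP/eqP => [/(digits_inj (eb k) (eb k'))/e_inj|->].
pose P := \sum_k u k *: 'X^(E k).
have P0 y : P.[y] = 0.
  rewrite horner_sum -[RHS](u0 (\col_i y ^+ (b ^ i))); apply: eq_bigr => k _.
  rewrite hornerZ hornerXn -prodrXr; congr (_ * _); apply: eq_bigr => i _.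
  by rewrite mxE -exprM mulnC.
have {P0} P0 : P = 0.
  apply/eqP/negPn/negP => Pn0.
  have := max_poly_roots (rs := [seq i%:R | i <- iota 0 (size P)]) Pn0.
  rewrite size_map size_iota ltnn => absurd; suff: false by [].
  apply: absurd; first by apply/allP => y _; rewrite rootE P0.
  by rewrite map_inj_uniq ?iota_uniq// => i j /eqP; rewrite eqr_nat => /eqP.
have := coef0 R (E k0); rewrite -P0 coef_sum (bigD1 k0)//= coefZ coefXn eqxx.
rewrite mulr1 big1 ?addr0// => k kk0.
by rewrite coefZ coefXn E_inj eq_sym (negbTE kk0) mulr0.
Qed.

Definition mnm_of (n l : nat) (a : n.-tuple 'I_l.+1) : multinom n :=
  Multinom [tuple tnth a i : nat | i < n].

Lemma mnm_of_inj (n l : nat) : injective (@mnm_of n l).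
Proof.
move=> a b ab; apply: eq_from_tnth => i; apply: val_inj.
by have := congr1 (fun m : multinom n => m i) ab; rewrite !multinomE !tnth_mktuple.
Qed.

Lemma mdeg_mnm_of (n l : nat) (a : n.-tuple 'I_l.+1) :
  mdeg (mnm_of a) = (\sum_(i <- a) i)%N.
Proof.
rewrite mdegE big_tuple; apply: eq_bigr => i _.
by rewrite multinomE tnth_mktuple.
Qed.

Lemma mnm_ofP (n l : nat) (m : multinom n) : mdeg m = l ->
  exists2 a, a \in multi n l & mnm_of a = m.
Proof.
move=> ml; have mi i : (m i < l.+1)%N.
  by rewrite ltnS -ml mdegE (bigD1 i)//= leq_addr.
exists [tuple Ordinal (mi i) | i < n]; last first.
  by apply/mnmP => i; rewrite multinomE !tnth_mktuple.
rewrite inE big_tuple; apply/eqP; rewrite -[RHS]ml mdegE.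
by apply: eq_bigr => i _; rewrite tnth_mktuple.
Qed.

(* The degree-l part of the sum defining a polynomial, over multi n l. *)
Lemma sum_multi (R : realType) (n l : nat) (s : seq (multinom n))
    (F : multinom n -> R) : uniq s -> (forall m, m \notin s -> F m = 0) ->
  \sum_(m <- s | mdeg m == l) F m =
  \sum_(k < #|multi n l|) F (mnm_of (enum_val k)).
Proof.
move=> s_uniq F0.
have -> : \sum_(k < #|multi n l|) F (mnm_of (enum_val k)) =
    \sum_(a in multi n l) F (mnm_of a) by rewrite [RHS]big_enum_val.
rewrite -big_enum /= -(big_map (@mnm_of n l) xpredT F).
rewrite (bigID (fun m => m \in s) xpredT) /= [X in _ = _ + X]big1 ?addr0; last first.
  by move=> m; exact: F0.
rewrite -big_filter -[RHS]big_filter; apply: perm_big; apply: uniq_perm.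
- exact: filter_uniq.
- by apply: filter_uniq; rewrite map_inj_uniq ?enum_uniq//; exact: mnm_of_inj.
move=> m; rewrite !mem_filter andbC; case: (m \in s) => //=.
apply/eqP/mapP => [/mnm_ofP[a aP <-]|[a]].
  by exists a => //; rewrite mem_enum.
by rewrite mem_enum inE => /eqP aP ->; rewrite mdeg_mnm_of.
Qed.

Lemma peval_multi (R : realType) (n : nat) (L : seq nat) (q : mpoly n R)
    (x : 'cV[R]_n) : uniq L -> (forall m, m \in msupp q -> mdeg m \in L) ->
  peval q x = \sum_(l <- L) \sum_(k < #|multi n l|)
    mcoeff (mnm_of (enum_val k)) q * monom (enum_val k) x.
Proof.
move=> L_uniq qL; rewrite /peval mevalE.
pose F (m : multinom n) := mcoeff m q * \prod_(i < n) x i 0 ^+ m i.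
transitivity (\sum_(m <- msupp q) \sum_(l <- L | mdeg m == l) F m).
  rewrite big_seq [RHS]big_seq; apply: eq_bigr => m /qL mL.
  rewrite -[RHS]big_filter (eq_filter (a2 := pred1 (mdeg m))); last first.
    by move=> l /=; rewrite eq_sym.
  by rewrite filter_pred1_uniq// big_seq1.
rewrite (exchange_big_dep xpredT)//=; apply: eq_bigr => l _.
rewrite (sum_multi l (F := F)) ?msupp_uniq//; last first.
  by move=> m /memN_msupp_eq0 m0; rewrite /F m0 mul0r.
apply: eq_bigr => k _; congr (_ * _); apply: eq_bigr => i _.
by rewrite multinomE tnth_mktuple.
Qed.

Lemma mxlift_exists (R : realType) (n l : nat) (A : 'M[R]_n) :
  exists B, forall x, B *m vlift l x = vlift l (A *m x).
Proof.
pose P (a : n.-tuple 'I_l.+1) : mpoly n R :=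
  \prod_(i < n) (\sum_(s < n) A i s *: mpolyX R (mnm1 s)) ^+ tnth a i.
have P_hom (a : n.-tuple 'I_l.+1) : a \in multi n l ->
    forall m, m \in msupp (P a) -> mdeg m \in [:: l].
  rewrite inE big_tuple => /eqP al; suff: P a \is ishomog1 l mdeg.
    by move/dhomogP => h m /h ml; rewrite inE -ml eqxx.
  rewrite -al /P; elim/big_rec2: _ => [|i y q _ IH]; first exact: dhomog1.
  apply: dhomogM => //; rewrite -[X in ishomog1 X]mul1n; apply: dhomogMn.
  apply: rpred_sum => s _; apply: dhomogZ; rewrite dhomogX; apply/eqP.
  exact: mdeg1.
have PE a x : peval (P a) x = monom a (A *m x).
  rewrite /peval rmorph_prod /=; apply: eq_bigr => i _.
  rewrite rmorphXn /= rmorph_sum /= !mxE; congr (_ ^+ _); apply: eq_bigr => s _.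
  by rewrite mevalZ mevalXU.
pose r (k : 'I_#|multi n l|) : R := Num.sqrt (multinom_coef R (enum_val k)).
exists (\matrix_(j, k) (r j / r k * mcoeff (mnm_of (enum_val k)) (P (enum_val j)))).
move=> x; apply/colP => j; rewrite !mxE -PE (peval_multi _ _ (P_hom _ (enum_valP j)))//.
rewrite big_seq1 mulr_sumr; apply: eq_bigr => k _; rewrite !mxE -/(r k).
have rk : r k != 0 by rewrite gt_eqF ?sqrt_multinom_coef_gt0.
by rewrite mulrACA divfK.
Qed.

Lemma mxliftE (R : realType) (n l : nat) (A : 'M[R]_n) (x : 'cV[R]_n) :
  mxlift l A *m vlift l x = vlift l (A *m x).
Proof. exact: (xgetPex 0 (mxlift_exists l A)). Qed.

Lemma mxliftLE (R : realType) (n : nat) (L : seq nat) (A : 'M[R]_n)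
    (x : 'cV[R]_n) : mxliftL L A *m vliftL L x = vliftL L (A *m x).
Proof. by rewrite mul_mxdiag_mxcol; apply: eq_mxcol => k; rewrite mxliftE. Qed.

Lemma vlift_span (R : realType) (n l : nat) (u : 'rV[R]_#|multi n l|) :
  (forall x : 'cV[R]_n, u *m vlift l x = 0) -> u = 0.
Proof.
move=> u0; apply/rowP => j; rewrite mxE.
pose e (k : 'I_#|multi n l|) (i : 'I_n) : nat := tnth (enum_val k) i.
pose r (k : 'I_#|multi n l|) : R := Num.sqrt (multinom_coef R (enum_val k)).
have e_inj k k' : e k =1 e k' -> k = k'.
  move=> ee; apply: enum_val_inj; apply: eq_from_tnth => i.
  by apply: val_inj; exact: ee.
have v0 : forall k, u 0 k * r k = 0.
  apply: (monom_free e_inj) => x.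
  have := congr1 (fun w : 'M[R]_1 => w 0 0) (u0 x); rewrite !mxE => h; rewrite -[RHS]h.
  by apply: eq_bigr => k _; rewrite mxE mulrA.
have /eqP := v0 j; rewrite mulf_eq0 => /orP[/eqP//|].
by rewrite gt_eqF ?sqrt_multinom_coef_gt0.
Qed.

Lemma vliftL_span (R : realType) (n : nat) (L : seq nat)
    (u : 'rV[R]_(liftdim n L)) : uniq L ->
  (forall x : 'cV[R]_n, u *m vliftL L x = 0) -> u = 0.
Proof.
move=> L_uniq u0.
pose I := {k : 'I_(size L) & 'I_#|multi n (nth 0%N L k)|}.
pose T (k : 'I_(size L)) (j : 'I_#|multi n (nth 0%N L k)|) : I := Tagged _ j.
pose e (K : I) (i : 'I_n) : nat := tnth (enum_val (tagged K)) i.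
pose r (k : 'I_(size L)) (j : 'I_#|multi n (nth 0%N L k)|) : R :=
  Num.sqrt (multinom_coef R (enum_val j)).
pose v (K : I) : R := submxrow u (tag K) 0 (tagged K) * r _ (tagged K).
have e_inj K K' : e K =1 e K' -> K = K'.
  move: K K' => [k j] [k' j'] ee.
  have degE (K : I) : (\sum_(i < n) e K i)%N = nth 0%N L (tag K).
    by have := enum_valP (tagged K); rewrite inE big_tuple => /eqP.
  have kk' : k = k'.
    apply/val_inj/eqP; rewrite -(nth_uniq 0%N (ltn_ord k) (ltn_ord k') L_uniq).
    by rewrite -(degE (Tagged _ j)) -(degE (Tagged _ j')) (eq_bigr _ (fun i _ => ee i)).
  move: kk' j' ee => <- j' ee; congr Tagged; apply: enum_val_inj.
  by apply: eq_from_tnth => i; apply: val_inj; exact: ee.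
have v0 : forall K, v K = 0.
  apply: (monom_free e_inj) => x.
  have := congr1 (fun w : 'M[R]_1 => w 0 0) (u0 x).
  rewrite [RHS]mxE -{1}(submxrowK u) mul_mxrow_mxcol summxE => h; rewrite -[RHS]h.
  rewrite (eq_bigr (fun k => \sum_j v (T k j) * monom (enum_val j) x)).
    rewrite (sig_big_dep xpredT (fun k _ => true)
      (fun k j => v (T k j) * monom (enum_val j) x)) /=.
    by apply: eq_bigr => -[k j] _.
  by move=> k _; rewrite mxE; apply: eq_bigr => j _; rewrite [vlift _ _ _ _]mxE mulrA.
rewrite -(submxrowK u) -(submxrowK 0); apply: eq_mxrow => k.
apply/rowP => j; rewrite submxrow0 [RHS]mxE.
have := v0 (T k j); rewrite /v /T /= => /eqP; rewrite mulf_eq0 => /orP[/eqP//|].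
by rewrite /r gt_eqF ?sqrt_multinom_coef_gt0.
Qed.

Lemma degrees_uniq (R : realType) (n p : nat) (c : 'I_p -> mpoly n R) :
  uniq (degrees c).
Proof. by rewrite sort_uniq undup_uniq. Qed.

Lemma mem_degrees (R : realType) (n p : nat) (c : 'I_p -> mpoly n R) (l : nat) :
  reflect (exists i, exists2 m, m \in msupp (c i) & mdeg m = l)
          (l \in degrees c).
Proof.
rewrite mem_sort mem_undup; apply: (iffP flattenP) => [[s /mapP[i _ ->]]|].
  by case/mapP => m mi ->; exists i, m.
move=> [i [m mi <-]]; exists [seq mdeg m | m <- msupp (c i)].
  by apply/mapP; exists i; rewrite ?mem_enum.
exact: map_f.
Qed.

Lemma liftdim_degrees (R : realType) (n p : nat) (c : 'I_p -> mpoly n R) :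
  (forall i m, m \in msupp (c i) -> (0 < mdeg m)%N) ->
  liftdim n (degrees c) = (\sum_(l <- degrees c) 'C(n + l - 1, l))%N.
Proof.
move=> c0; rewrite (big_nth 0%N) big_mkord; apply: eq_bigr => k _.
apply: card_multi; have := mem_nth 0%N (ltn_ord k).
by move=> /(mem_degrees c)[i [m /c0 ? <-]].
Qed.

Lemma constraint_vec_exists (R : realType) (n p : nat) (c : 'I_p -> mpoly n R)
    (i : 'I_p) :
  exists g : 'cV[R]_(liftdim n (degrees c)),
    forall x, peval (c i) x = (g^T *m vliftL (degrees c) x) 0 0.
Proof.
set L := degrees c.
exists (\mxcol_(k < size L) \col_(j < #|multi n (nth 0%N L k)|)
  (mcoeff (mnm_of (enum_val j)) (c i) / Num.sqrt (multinom_coef R (enum_val j)))).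
move=> x; rewrite tr_mxcol mul_mxrow_mxcol summxE.
rewrite (peval_multi _ (degrees_uniq c)); last first.
  by move=> m mi; apply/mem_degrees; exists i, m.
rewrite (big_nth 0%N) big_mkord; apply: eq_bigr => k _; rewrite mxE.
apply: eq_bigr => j _; rewrite !mxE mulrA divfK//.
by rewrite gt_eqF ?sqrt_multinom_coef_gt0.
Qed.

Lemma constraint_vecE (R : realType) (n p : nat) (c : 'I_p -> mpoly n R)
    (i : 'I_p) (x : 'cV[R]_n) :
  peval (c i) x = ((constraint_vec c i)^T *m vliftL (degrees c) x) 0 0.
Proof. exact: (xgetPex 0 (constraint_vec_exists c i)). Qed.

Lemma constraint_vec_uniq (R : realType) (n p : nat) (c : 'I_p -> mpoly n R)
    (i : 'I_p) (g : 'cV[R]_(liftdim n (degrees c))) :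
  (forall x, peval (c i) x = (g^T *m vliftL (degrees c) x) 0 0) ->
  g = constraint_vec c i.
Proof.
move=> gE; apply: trmx_inj; apply/eqP; rewrite -subr_eq0; apply/eqP.
apply: vliftL_span (degrees_uniq c) _ => x; apply/rowP => j; rewrite ord1.
by rewrite mulmxBl mxE [X in _ + X]mxE [RHS]mxE -gE -constraint_vecE subrr.
Qed.

Lemma mxlift_uniq (R : realType) (n l : nat) (A : 'M[R]_n)
    (B : 'M[R]_#|multi n l|) :
  (forall x, B *m vlift l x = vlift l (A *m x)) -> B = mxlift l A.
Proof.
move=> BE; apply/eqP; rewrite -subr_eq0; apply/eqP/row_matrixP => i.
rewrite row0; apply: vlift_span => x.
by rewrite -row_mul mulmxBl BE mxliftE subrr row0.
Qed.

(* Main.v *)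
Require Import Defs.
From HB Require Import structures.
From mathcomp Require Import all_boot all_order all_algebra.
From mathcomp Require Import all_classical all_reals all_analysis.
From mathcomp Require mpoly.
Import -(notations) mpoly.

Set Implicit Arguments.
Unset Strict Implicit.
Unset Printing Implicit Defensive.

Import Order.TTheory GRing.Theory Num.Theory numFieldNormedType.Exports.
Local Open Scope classical_set_scope.
Local Open Scope ring_scope.

(** The lift intertwines the dynamics, A^[L] x^[L] = (A x)^[L], so the iterate
    S_k consists of the y whose image under every lifted product of at most k
    factors satisfies the lifted constraints (lifted_iterP).  Two facts then give
    the theorem.

    If lower (S_k) is included in lower (S_(k+1)), then lower (S_k) is mapped into
    itself by every mode; it lies in X because S_k lies in S_0, and it contains
    every admissible invariant set because the trajectories from such a set stay
    in X (lower_iter_maximal).  For x in lower (S_k), the point x^[L] lies in the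
    Veronese variety and in S_0, hence in B; so equality of S_k and S_(k+1) inside
    B is all that is needed.

    Inside B the iterates become stationary because long products of the lifted
    matrices are uniformly small: they map the bounded set B into a ball around 0
    on which all the lifted constraints hold, so words of length k+1 add nothing
    to words of length at most k (lifted_iter_stationary).  The uniform decay
    (wordmx_decay) is derived directly for the lifted matrices, without computing
    a joint spectral radius.  Trajectories of the lifted system that start on the
    Veronese variety are lifts of trajectories of the original one, so they tend to
    0 because all degrees are positive; since the variety spans the whole space,
    every lifted trajectory tends to 0 (lifted_attractive).  Thus along each signal
    some prefix halves all norms, and compactness of the space of signals, in the
    form of Koenig's lemma (bar_uniform), bounds the length of such a prefix
    uniformly over the signals.  Every long word is then cut into many halving
    blocks of bounded length and a remainder of bounded length. *)

(** * Koenig's lemma for words over a finite alphabet *)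

(** If no uniform T existed, the empty word would have extensions of every length
    without a prefix in Q; by finiteness of the alphabet one letter can be appended
    to such a word so that it keeps this property, and repeating this produces an
    infinite word that avoids Q. *)
Lemma bar_uniform (I : finType) (Q : seq I -> Prop) :
  (forall sigma : nat -> I, exists t, Q (mkseq sigma t)) ->
  exists T, forall w, (T <= size w)%N -> exists t, Q (take t w).
Proof.
move=> Qbar.
pose bounded w :=
  exists T, forall v, (T <= size v)%N -> exists t, Q (take t (w ++ v)).
have bounded_rcons w : (forall i, bounded (rcons w i)) -> bounded w.
  move=> /choice[T TP]; exists (\max_i T i).+1 => -[//|i v] /= ltv.
  by rewrite -cat_rcons; apply: TP; exact: leq_trans (leq_bigmax i) ltv.
apply: (contrapT (P := bounded [::])) => unbounded0.
(* A letter is needed to define the next step at every word, bounded or not. *)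
have [i0 _] : exists i, ~ bounded [:: i].
  by apply/existsNP => b1; apply: unbounded0; exact: bounded_rcons.
have step w : exists i, ~ bounded w -> ~ bounded (rcons w i).
  have [bw|ubw] := pselect (bounded w); first by exists i0.
  have /existsNP[i ubi] : ~ forall i, bounded (rcons w i).
    by move=> /bounded_rcons.
  by exists i.
have [next nextP] := choice step.
pose branch t := iter t (fun w => rcons w (next w)) [::].
have branchE t : mkseq (next \o branch) t = branch t.
  by elim: t => [//|t IH]; rewrite mkseqS IH.
have branch_unbounded t : ~ bounded (branch t).
  by elim: t => [//|t IH]; exact: nextP.
have [t Qt] := Qbar (next \o branch).
apply: (branch_unbounded t); exists 0%N => v _; exists t.
have sz : size (branch t) = t by rewrite -branchE size_mkseq.
by rewrite take_cat sz ltnn subnn take0 cats0 -branchE.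
Qed.

(** * The maximum norm on matrices *)

Section MatrixNorm.
Variable R : realType.

Lemma mx_norm_coord m n (P : 'M[R]_(m, n)) i j : `|P i j| <= `|P|.
Proof.
rewrite [leRHS]/Num.Def.normr /= mx_normrE.
by apply/bigmax_geP; right; exists (i, j).
Qed.

Lemma mx_norm_le m n (P : 'M[R]_(m, n)) (e : R) :
  0 <= e -> (forall i j, `|P i j| <= e) -> `|P| <= e.
Proof.
move=> e0 Pe; rewrite [leLHS]/Num.Def.normr /= mx_normrE.
by apply/bigmax_leP; split=> // -[i j] _; exact: Pe.
Qed.

Lemma mx_norm_mul m n q (P : 'M[R]_(m, n)) (Q : 'M[R]_(n, q)) :
  `|P *m Q| <= n%:R * `|P| * `|Q|.
Proof.
apply: mx_norm_le => [|i j]; first by rewrite !mulr_ge0.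
rewrite mxE (le_trans (ler_norm_sum _ _ _))//.
rewrite -mulrA mulr_natl -[X in _ *+ X]card_ord -sumr_const.
by apply: ler_sum => k _; rewrite normrM ler_pM// mx_norm_coord.
Qed.

Lemma mx_cvg m n {T : Type} (F : set_system T) {FF : Filter F}
    (P : T -> 'M[R]_(m, n)) (Q : 'M[R]_(m, n)) :
  (forall i j, P x i j @[x --> F] --> Q i j) -> P @ F --> Q.
Proof.
move=> PQ; apply/cvgrPdist_le => e e0.
have : \forall x \near F, forall i j, `|Q i j - P x i j| <= e.
  apply: filter_forall => i; apply: filter_forall => j.
  by move/cvgrPdist_le: (PQ i j); exact.
apply: filterS => x Pe; apply: mx_norm_le => [|i j]; first exact: ltW.
by rewrite !mxE.
Qed.

End MatrixNorm.

(** * Uniform decay of matrix products *)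

Section Words.
Variables (R : realType) (n M : nat) (A : 'I_M -> 'M[R]_n).
Implicit Types (w : seq 'I_M) (y : 'cV[R]_n).

(** The head of the word acts first, so it is the rightmost factor: this is the
    order in which a signal is read along a trajectory. *)
Fixpoint wordmx w : 'M[R]_n :=
  if w is i :: w' then wordmx w' *m A i else 1%:M.

Lemma wordmx_cat u v : wordmx (u ++ v) = wordmx v *m wordmx u.
Proof. by elim: u => [|i u IH] /=; rewrite ?mulmx1// IH mulmxA. Qed.

Lemma trajectory_wordmx sigma y t :
  trajectory A sigma y t = wordmx (mkseq sigma t) *m y.
Proof.
elim: t => [|t IH]; first by rewrite mul1mx.
by rewrite mkseqS -cats1 wordmx_cat /= mul1mx IH mulmxA.
Qed.

Lemma wordmx_growth : exists2 b : R, 1 <= b &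
  forall w y, `|wordmx w *m y| <= b ^+ size w * `|y|.
Proof.
have b0 : 0 <= \sum_i n%:R * `|A i| by apply: sumr_ge0 => i _; rewrite mulr_ge0.
exists (1 + \sum_i n%:R * `|A i|); first by rewrite lerDl.
elim=> [|i w IH] y /=; first by rewrite expr0 mul1r mul1mx.
rewrite -mulmxA (le_trans (IH _))// exprSr -mulrA ler_wpM2l//.
  by rewrite exprn_ge0// addr_ge0.
rewrite (le_trans (mx_norm_mul _ _))// ler_wpM2r//.
by rewrite (bigD1 i)//= addrCA lerDl addr_ge0// sumr_ge0.
Qed.

(** The columns of the product along sigma are the trajectories of the basis
    vectors, so the whole matrix tends to 0, and smallness of a matrix contracts
    all vectors at once. *)
Lemma wordmx_contraction sigma :
  (forall y, trajectory A sigma y @ \oo --> (0 : 'cV[R]_n)) ->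
  exists t, (0 < t)%N /\
    forall y, `|wordmx (mkseq sigma t) *m y| <= 2^-1 * `|y|.
Proof.
move=> attr.
have W0 : wordmx (mkseq sigma t) @[t --> \oo] --> (0 : 'M[R]_n).
  apply: mx_cvg => i j.
  have -> : (fun t => wordmx (mkseq sigma t) i j) =
      (fun t => trajectory A sigma (delta_mx j 0) t i 0).
    by apply/funext => t; rewrite trajectory_wordmx -colE mxE.
  have -> : (0 : 'M[R]_n) i j = (0 : 'cV[R]_n) i 0 by rewrite !mxE.
  exact: cvg_comp (attr _) (@coord_continuous R n 1 i 0 0).
(* The factor n.+1 absorbs the dimension in mx_norm_mul. *)
have e0 : 0 < (2 * n.+1%:R)^-1 :> R by rewrite invr_gt0 mulr_gt0.
have [t [t0 Wt]] : exists t, (0 < t)%N /\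
    `|wordmx (mkseq sigma t)| <= (2 * n.+1%:R)^-1.
  have near_t : \forall t \near \oo, (0 < t)%N /\
      `|wordmx (mkseq sigma t)| <= (2 * n.+1%:R)^-1.
    by near=> t; split; [near: t; exact: nbhs_infty_gt |
      near: t; exact: cvgr0_norm_le W0 _ e0].
  exact: filter_ex near_t.
exists t; split=> // y; rewrite (le_trans (mx_norm_mul _ _))// ler_wpM2r//.
rewrite (le_trans (ler_wpM2l _ Wt))// invfM mulrCA ler_piMr//.
by rewrite ler_pdivrMr// mul1r ler_nat.
Unshelve. all: by end_near. Qed.

(** Attractivity along each single signal is enough for uniform decay over all
    words: bar_uniform yields a length T such that every word of length at least T
    starts with a nonempty halving prefix of length at most T.  A word of length at
    least m T therefore contains m halving prefixes in succession. *)
Lemma wordmx_decay :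
  (forall sigma y, trajectory A sigma y @ \oo --> (0 : 'cV[R]_n)) ->
  forall r e : R, 0 < e -> exists K, forall w, (K <= size w)%N ->
    forall y, `|y| <= r -> `|wordmx w *m y| <= e.
Proof.
move=> attr r e e0.
pose contracts w := (0 < size w)%N /\
  forall y, `|wordmx w *m y| <= 2^-1 * `|y|.
have [sigma|T TP] := @bar_uniform _ contracts.
  have [t [t0 Wt]] := wordmx_contraction (attr sigma).
  by exists t; split=> //; rewrite size_mkseq.
have split_word w : (T <= size w)%N ->
    exists u v, [/\ w = u ++ v, (size u <= T)%N & contracts u].
  move=> Tw; have [|t Qt] := TP (take T w); first by rewrite size_takel.
  exists (take t (take T w)), (drop t (take T w) ++ drop T w).
  rewrite catA !cat_take_drop; split=> //.
  by rewrite size_take_min size_takel// geq_minr.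
have [b b1 bP] := wordmx_growth.
have b0 : 0 <= b by exact: le_trans b1.
have geom m w y : (m * T <= size w)%N ->
    `|wordmx w *m y| <= b ^+ T * 2^-1 ^+ m * `|y|.
  elim: m w y => [|m IHm] w y.
    (* A halving prefix does not increase norms, so it can be removed until the
       remaining word is shorter than T and grows norms by at most b ^+ T. *)
    rewrite expr0 mulr1 => _; move: {2}(size w) (leqnn (size w)) => s.
    elim: s w y => [|s IHs] w y ws.
      rewrite (le_trans (bP _ _))// ler_wpM2r// ler_weXn2l//.
      exact: leq_trans ws _.
    have [wT|Tw] := ltnP (size w) T.
      by rewrite (le_trans (bP _ _))// ler_wpM2r// ler_weXn2l// ltnW.
    have [u [v [wE _ [u0 uP]]]] := split_word w Tw.
    rewrite wE wordmx_cat -mulmxA (le_trans (IHs _ _ _))//.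
      by rewrite -ltnS (leq_trans _ ws)// wE size_cat -addn1 addnC leq_add2r.
    rewrite ler_wpM2l ?exprn_ge0// (le_trans (uP _))// ler_piMl//.
    by rewrite invf_le1// ler1n.
  rewrite mulSn => Tw.
  have [u [v [wE uT [_ uP]]]] := split_word w (leq_trans (leq_addr _ _) Tw).
  rewrite wE wordmx_cat -mulmxA (le_trans (IHm _ _ _))//.
    move: Tw; rewrite wE size_cat => Tw.
    by rewrite -(leq_add2l T) (leq_trans Tw)// leq_add2r.
  rewrite exprSr [_ ^+ T * (_ * _)]mulrA -[leRHS]mulrA ler_wpM2l//.
  by rewrite mulr_ge0 ?exprn_ge0// invr_ge0.
have [m mP] : exists m, b ^+ T * 2^-1 ^+ m * `|r| <= e.
  have : b ^+ T * `|r| * 2^-1 ^+ m @[m --> \oo] --> (0 : R).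
    rewrite -[X in _ --> X](mulr0 (b ^+ T * `|r|)); apply: cvgMr.
    by apply: cvg_expr; rewrite ger0_norm ?invr_ge0// invf_lt1// ltr1n.
  move=> /cvgr0_norm_le/(_ e e0) near_m; have [m] := filter_ex near_m.
  move=> me; exists m; rewrite mulrAC; exact: le_trans (ler_norm _) me.
exists (m * T)%N => w mw y yr; rewrite (le_trans (geom m w y mw))//.
apply: le_trans mP; rewrite ler_wpM2l//.
  by rewrite mulr_ge0 ?exprn_ge0// invr_ge0.
exact: le_trans yr (ler_norm _).
Qed.

End Words.

(** * The lifted system *)

Section LiftedDynamics.
Variables (R : realType) (n : nat) (L : seq nat).

(** The Veronese variety spans the lifted space, since no nonzero linear form
    vanishes on it.  The spanning family is built one vector at a time: as long as
    the rank of U is not full, some lifted vector lies outside the row space of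
    U and can be added to it. *)
Lemma veronese_ind (G : 'cV[R]_(liftdim n L) -> Prop) : uniq L ->
  G 0 -> (forall a u v, G u -> G v -> G (a *: u + v)) ->
  (forall x, G (vliftL L x)) -> forall y, G y.
Proof.
move=> L_uniq G0 Glin Gv.
have span r : (r <= liftdim n L)%N ->
    exists2 U : 'M[R]_(liftdim n L), (r <= \rank U)%N &
      forall u : 'rV_(liftdim n L), (u <= U)%MS -> G u^T.
  elim: r => [_|r IH rN].
    by exists 0 => // u; rewrite submx0 => /eqP ->; rewrite trmx0.
  have [U Ur UG] := IH (ltnW rN).
  have [rU|Ule] := ltnP r (\rank U); first by exists U.
  have [x xU] : exists x, ~~ ((vliftL L x)^T <= U)%MS.
    apply: contrapT => /forallNP vU.
    have /eqP : cokermx U = 0.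
      apply: trmx_inj; apply/row_matrixP => i; rewrite trmx0 row0.
      apply: vliftL_span => // x; rewrite -row_mul.
      have := vU x; rewrite submxE => /negP/negPn/eqP vx0.
      by rewrite -[vliftL L x]trmxK -trmx_mul vx0 trmx0 row0.
    rewrite -mxrank_eq0 mxrank_coker subn_eq0 leqNgt.
    by rewrite (leq_ltn_trans Ule rN).
  exists (U + (vliftL L x)^T)%MS.
    apply: leq_ltn_trans Ur _.
    have : (U < U + (vliftL L x)^T)%MS.
      by rewrite ltmxE addsmxSl addsmx_sub submx_refl.
    by rewrite ltmxErank => /andP[].
  move=> u /sub_addsmxP[[a b] /= ->].
  rewrite addrC linearD /= [b]mx11_scalar mul_scalar_mx linearZ /= trmxK.
  by apply: Glin => //; apply: UG; exact: submxMl.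
have [U Ur UG] := span _ (leqnn _).
move=> y; rewrite -[y]trmxK; apply: UG; apply: submx_full.
by rewrite /row_full eqn_leq rank_leq_col.
Qed.


Lemma vliftL_continuous : continuous (@vliftL R n L).
Proof.
have monom_continuous l (a : n.-tuple 'I_l.+1) :
    continuous (@monom R n l a).
  apply: continuous_big => [|i _]; first exact: mul_continuous.
  move=> x; apply: (@continuous_comp _ _ _ (fun y : 'cV[R]_n => y i 0)
    (fun r => r ^+ tnth a i)); first exact: coord_continuous.
  exact: exprn_continuous.
move=> x; apply: (mx_cvg (FF := nbhs_filter x)) => i j; rewrite mxE mxE.
under eq_cvg do rewrite mxE mxE.
by apply: cvgMr; exact: monom_continuous.
Qed.

Lemma vliftL0 : (forall l, l \in L -> (0 < l)%N) ->
  vliftL L (0 : 'cV[R]_n) = 0.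
Proof.
move=> L_gt0; rewrite -[RHS]mxcol0; apply: eq_mxcol => k.
apply/colP => j; rewrite !mxE.
have := enum_valP j; rewrite inE big_tuple => /eqP dega.
have [i ai] : exists i, tnth (enum_val j) i != 0%N :> nat.
  apply: contrapT => /forallNP a0.
  have := L_gt0 _ (mem_nth 0%N (ltn_ord k)).
  by rewrite -dega big1// => i _; apply/eqP/negPn/negP; exact: a0.
by rewrite /monom (bigD1 i)//= mxE expr0n (negbTE ai) mul0r mulr0.
Qed.


Section LiftedSystem.
Variables (M : nat) (A : 'I_M -> 'M[R]_n).
Let liftA i := mxliftL L (A i).

Lemma wordmx_vliftL w (x : 'cV[R]_n) :
  wordmx liftA w *m vliftL L x = vliftL L (wordmx A w *m x).
Proof.
elim: w x => [|i w IH] x /=; first by rewrite !mul1mx.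
by rewrite -!mulmxA mxliftLE IH.
Qed.

(** Continuity of the lift gives the claim for initial states on the Veronese
    variety; linearity of the lifted dynamics extends it to their span. *)
Lemma lifted_attractive : uniq L -> (forall l, l \in L -> (0 < l)%N) ->
  (forall sigma x, trajectory A sigma x @ \oo --> (0 : 'cV[R]_n)) ->
  forall sigma y,
    trajectory liftA sigma y @ \oo --> (0 : 'cV[R]_(liftdim n L)).
Proof.
move=> L_uniq L_gt0 attr sigma; apply: veronese_ind => // [|a u v u0 v0|x].
- have -> : trajectory liftA sigma 0 = fun=> 0.
    by apply/funext => t; rewrite trajectory_wordmx mulmx0.
  exact: cvg_cst.
- have -> : trajectory liftA sigma (a *: u + v) = fun t =>
      a *: trajectory liftA sigma u t + trajectory liftA sigma v t.
    by apply/funext => t; rewrite !trajectory_wordmx linearD linearZ.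
  have := cvgD (cvgZ (cvg_cst a) u0) v0; rewrite scaler0 addr0; exact.
have -> : trajectory liftA sigma (vliftL L x) =
    vliftL L \o trajectory A sigma x.
  by apply/funext => t /=; rewrite !trajectory_wordmx wordmx_vliftL.
rewrite -[X in _ --> X](vliftL0 L_gt0).
exact: cvg_comp (attr sigma x) (@vliftL_continuous _).
Qed.

End LiftedSystem.
End LiftedDynamics.

(** * The iterates and the maximal invariant set *)

Section Iterates.
Variables (R : realType) (n M p : nat).
Variables (A : 'I_M -> 'M[R]_n) (c : 'I_p -> mpoly n R).
Let liftA i := mxliftL (degrees c) (A i).

Lemma constraint_set_lower :
  constraint_set c = lower (lifted_constraint_set c).
Proof.
apply/funext => x; apply/propext.
by split=> xX i; have := xX i; rewrite constraint_vecE.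
Qed.

Lemma lifted_iterP k y : lifted_iter c A k y <->
  forall w, (size w <= k)%N -> lifted_constraint_set c (wordmx liftA w *m y).
Proof.
elim: k y => [|k IH] y.
  by split=> [Sy [|//] _|/(_ [::] isT)]; rewrite /= mul1mx.
split=> [[Sy S0y] [|i w] /= wk|Sy]; first by rewrite mul1mx.
  by rewrite -mulmxA; apply: (IH _).1 (Sy i) _ wk.
split=> [i|]; last by have := Sy [::] isT; rewrite /= mul1mx.
by apply/IH => w wk; rewrite mulmxA; exact: Sy (i :: w) wk.
Qed.

Lemma lifted_constraint_set_ball :
  exists2 e : R, 0 < e & forall y, `|y| <= e -> lifted_constraint_set c y.
Proof.
pose b i : R := (liftdim n (degrees c))%:R * `|(constraint_vec c i)^T|.
have b0 i : 0 <= b i by rewrite mulr_ge0.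
have B0 : 0 < 1 + \sum_i b i by rewrite ltr_pwDl// sumr_ge0.
exists (1 + \sum_i b i)^-1; first by rewrite invr_gt0.
move=> y ye i; rewrite (le_trans (ler_norm _))//.
rewrite (le_trans (mx_norm_coord _ _ _))//.
rewrite (le_trans (mx_norm_mul _ _))// -/(b i).
rewrite (le_trans (ler_wpM2l (b0 i) ye))// ler_pdivrMr// mul1r.
by rewrite (bigD1 i)//= addrCA lerDl addr_ge0// sumr_ge0.
Qed.

(** The hypothesis is stationarity after lowering only; it says that one step of
    any mode maps lower (S_k) into itself. *)
Lemma lower_iter_maximal k :
  lower (lifted_iter c A k) `<=` lower (lifted_iter c A k.+1) ->
  maximal_admissible_invariant A (constraint_set c)
    (lower (lifted_iter c A k)).
Proof.
move=> Sk; split; first split.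
- move=> x Sx sigma; elim=> [//|t /Sk[St _]] /=.
  by have := St (sigma t); rewrite mxliftLE.
- rewrite constraint_set_lower => x /lifted_iterP/(_ [::] isT).
  by rewrite mul1mx.
move=> S [Sinv SX] x Sx; apply/lifted_iterP => w _.
rewrite wordmx_vliftL; suff /SX : S (wordmx A w *m x).
  by rewrite constraint_set_lower.
elim: w x Sx => [|i w IH] x Sx /=; first by rewrite mul1mx.
by rewrite -mulmxA; apply: IH; exact: Sinv x Sx (fun=> i) 1%N.
Qed.

(** Since B is bounded, all sufficiently long lifted products map it into the ball
    of lifted_constraint_set_ball. *)
Lemma lifted_iter_stationary (B : set 'cV[R]_(liftdim n (degrees c))) :
  (forall i m, m \in msupp (c i) -> (0 < mdeg m)%N) ->
  (forall sigma x, trajectory A sigma x @ \oo --> (0 : 'cV[R]_n)) ->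
  (exists r : R, forall y, B y -> `|y| <= r) ->
  exists K, forall k, (K <= k)%N ->
    lifted_iter c A k `&` B = lifted_iter c A k.+1 `&` B.
Proof.
move=> c_gt0 attr [r Br].
have [e e0 eX] := lifted_constraint_set_ball.
have degrees_gt0 l : l \in degrees c -> (0 < l)%N.
  by move=> /mem_degrees[i [m /c_gt0 ? <-]].
have liftattr := lifted_attractive (degrees_uniq c) degrees_gt0 attr.
have [K KP] := wordmx_decay liftattr r e0.
exists K => k Kk; apply/seteqP; split=> y [Sy By]; split=> //; apply/lifted_iterP.
  move=> w; rewrite leq_eqVlt => /predU1P[wk|].
    (* The new constraints, from words of length k.+1, hold on all of B. *)
    by apply/eX/KP; [rewrite wk ltnW | exact: Br].
  exact: (lifted_iterP _ _).1 Sy w.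
by move=> w wk; apply: (lifted_iterP _ _).1 Sy w (leqW wk).
Qed.

End Iterates.

Theorem theorem2 (R : realType) (n M p d : nat)
    (A : 'I_M -> 'M[R]_n) (c : 'I_p -> mpoly n R)
    (d_ge1 : (1 <= d)%N)
    (c_deg : forall i m, m \in msupp (c i) -> (1 <= mdeg m <= d)%N)
    (A_stable : asymptotically_stable A)
    (X_closed : closed (constraint_set c))
    (X_bounded : bounded_set (constraint_set c))
    (X_origin : (constraint_set c)° 0)
    (B : set 'cV[R]_(liftdim n (degrees c)))
    (B_compact : compact B)
    (VX_sub_B :
       veronese (degrees c) `&` lifted_constraint_set c `<=` B) :
  exists k : nat,
    [/\ (1 <= k)%N,
        lifted_iter c A k `&` B = lifted_iter c A k.+1 `&` B &
        maximal_admissible_invariant A (constraint_set c)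
          (lower (lifted_iter c A k))].
Proof.
have [K stationary] : exists K, forall k, (K <= k)%N ->
    lifted_iter c A k `&` B = lifted_iter c A k.+1 `&` B.
  apply: lifted_iter_stationary => [i m /c_deg/andP[]//|sigma x|].
    exact: (A_stable sigma).2.
  have [r [_ rB]] := compact_bounded B_compact.
  by exists (r + 1) => y By; apply: rB => //; rewrite ltrDl.
exists K.+1; split=> //; first exact: stationary.
apply: lower_iter_maximal => x Sx.
(* A point of lower (S_k) has its lift in B, where S_k and S_(k+1) agree. *)
suff : (lifted_iter c A K.+1 `&` B) (vliftL (degrees c) x).
  by rewrite stationary// => -[].
split=> //; apply: VX_sub_B; split; first by exists x.
by have /lifted_iterP/(_ [::] isT) := Sx; rewrite mul1mx.
Qed.
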